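(* Let $\ell(\cdot,y_i)$ satisfy $\ell''(z,y_i)\ge\beta$ for all $|z|\le r$ and all $i=1,\dots,n$, where $\beta>0$. Let $\lambda>0$, $L>0$, $\rho=\lambda/\beta$, and let $R$ satisfy $\|x_i\|_2\le R$ for all $i$. (1) If $\ell(\cdot,y_i)$ is $L$-Lipschitz continuous for every $i$ and $$\frac{\lambda(L+\beta r)^2}{\beta L^2}\le\frac{R^2}{\mu(\rho)\gamma(C,\rho)},$$ then the condition number (in the Lipschitz sense) of the preconditioned problem $$\min_{v\in\mathbb{R}^d}\ \frac1n\sum_{i=1}^n\phi(v^\top H^{-1/2}x_i,y_i)+\frac{\beta}{2}\|v\|_2^2$$ is at most $L^2R^2/\lambda$, the condition number of the original problem. (2) If $\ell(\cdot,y_i)$ is $L$-smooth for every $i$ and $$\frac{\lambda}{\beta}-\frac{\lambda}{L}\le\frac{R^2}{\mu(\rho)\gamma(C,\rho)},$$ then the condition number (in the smooth sense) of the preconditioned problem is at most $LR^2/\lambda$, the condition number of the original problem.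
   Context: Data: $x_1,\dots,x_n\in\mathbb{R}^d$ (not all zero), labels $y_1,\dots,y_n$; $\ell(z,y)$ is a loss function, convex in its first (scalar) argument $z$. The original problem is $\min_{w\in\mathbb{R}^d}\frac1n\sum_{i=1}^n\ell(x_i^\top w,y_i)+\frac{\lambda}{2}\|w\|_2^2$; by convention its condition number is $L^2R^2/\lambda$ when $\ell(\cdot,y)$ is $L$-Lipschitz and $LR^2/\lambda$ when $\ell(\cdot,y)$ is $L$-smooth. The number $r>0$ is an upper bound on the absolute value of the first argument of the loss (the predictions occurring during optimization); throughout, the loss is only considered for $|z|\le r$. Definitions: $\phi(z,y)=\ell(z,y)-\frac{\beta}{2}z^2$; $C=\frac1n\sum_{i=1}^n x_ix_i^\top$; $H=\rho I+C$. A scalar function is $L$-Lipschitz if $|f(z_1)-f(z_2)|\le L|z_1-z_2|$, and $L$-smooth if it is differentiable with $L$-Lipschitz derivative. Let $X=(x_1,\dots,x_n)\in\mathbb{R}^{d\times n}$ with singular value decomposition $\frac{1}{\sqrt n}X=U\Sigma V^\top$, where $n\ge d$, $U\in\mathbb{R}^{d\times d}$ is orthogonal, $V\in\mathbb{R}^{n\times d}$ has orthonormal columns, $\Sigma=\mathrm{diag}(\sigma_1,\dots,\sigma_d)$, $\sigma_1\ge\dots\ge\sigma_d\ge0$. The numerical rank is $\gamma(C,\rho)=\sum_{j=1}^d\frac{\sigma_j^2}{\sigma_j^2+\rho}$. The generalized incoherence is $$\mu(\rho)=\max_{1\le i\le n}\frac{n}{\gamma(C,\rho)}\sum_{j=1}^d\frac{\sigma_j^2}{\sigma_j^2+\rho}V_{ij}^2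 .$$ Condition number of the preconditioned problem: in the Lipschitz sense it is $\bar L^2/\beta$, where $\bar L$ is the smallest common Lipschitz constant (Euclidean norm, with respect to $v$) of the functions $v\mapsto\phi(v^\top H^{-1/2}x_i,y_i)$ on $\{v:|v^\top H^{-1/2}x_i|\le r\}$, $i=1,\dots,n$; in the smooth sense it is $\bar L/\beta$, where $\bar L$ is the smallest common Lipschitz constant of the gradients of these functions on the same sets. *)

(* Defs.v *)
From HB Require Import structures.
From mathcomp Require Import all_boot all_order all_algebra.
From mathcomp Require Import all_classical all_reals all_analysis.

Set Implicit Arguments.
Unset Strict Implicit.
Unset Printing Implicit Defensive.

Import Order.TTheory GRing.Theory Num.Theory.
Import numFieldNormedType.Exports.

Local Open Scope ring_scope.
Local Open Scope classical_set_scope.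

Section Euclidean.
Context {R : realType}.

Definition dot d (u v : 'cV[R]_d) : R := \sum_j u j 0 * v j 0.

(* The library norm `| v | on matrices is the sup norm. *)
Definition enorm d (v : 'cV[R]_d) : R := Num.sqrt (dot v v).

Definition grad d (f : 'cV[R]_d -> R) (v : 'cV[R]_d) : 'cV[R]_d :=
  \col_j 'D_(delta_mx j 0) f v.

Definition psd d (A : 'M[R]_d) : Prop :=
  A^T = A /\ forall v : 'cV[R]_d, 0 <= dot v (A *m v).

(* A^{-1/2}: the positive semidefinite square root of A^{-1}. It exists and is
   unique when A is symmetric positive definite; junk value otherwise. *)
Definition invsqrtmx d (A : 'M[R]_d) : 'M[R]_d :=
  get [set S : 'M[R]_d | psd S /\ S *m S = invmx A].

End Euclidean.

Section Loss.
Context {R : realType}.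

(* The first conjunct keeps f^`() from being a junk value next to z. *)
Definition twice_derivable_at (f : R -> R) (z : R) : Prop :=
  (\forall t \near z, derivable f t 1) /\ derivable f^`() z 1.

Definition smooth_on (A : set R) (L : R) (f : R -> R) : Prop :=
  (forall z, A z -> derivable f z 1) /\ L.-lipschitz_A f^`().

Definition phi (Y : Type) (loss : R -> Y -> R) (beta z : R) (y : Y) : R :=
  loss z y - beta / 2 * z ^+ 2.

End Loss.

Section Data.
Context {R : realType} {d n : nat}.
Implicit Types (x : 'I_n -> 'cV[R]_d) (sigma : 'I_d -> R) (V : 'M[R]_(n, d)).

Definition data_mx x : 'M[R]_(d, n) := \matrix_(j, i) x i j 0.

Definition covmx x : 'M[R]_d := n%:R^-1 *: \sum_i x i *m (x i)^T.

Definition precond_mx x (rho : R) : 'M[R]_d := rho%:M + covmx x.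

Definition is_svd x (U : 'M[R]_d) sigma V : Prop :=
  [/\ (Num.sqrt n%:R)^-1 *: data_mx x = U *m diag_mx (\row_j sigma j) *m V^T,
      U^T *m U = 1%:M,
      V^T *m V = 1%:M,
      (forall j, 0 <= sigma j) &
      (forall j k : 'I_d, (j <= k)%N -> sigma k <= sigma j)].

(* gamma(C, rho), expressed through the singular values of X / sqrt n *)
Definition numrank sigma (rho : R) : R :=
  \sum_j sigma j ^+ 2 / (sigma j ^+ 2 + rho).

(* The terms are nonnegative, so starting the maximum at 0 is harmless. *)
Definition incoherence sigma V (rho : R) : R :=
  \big[Num.max/0]_(i < n)
    (n%:R / numrank sigma rho *
     \sum_j sigma j ^+ 2 / (sigma j ^+ 2 + rho) * V i j ^+ 2).

End Data.

Section ConditionNumber.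
Context {R : realType} {d n : nat}.
Variables (Y : Type) (loss : R -> Y -> R) (beta rho r : R).
Variables (x : 'I_n -> 'cV[R]_d) (y : 'I_n -> Y).

Definition precond_pt (i : 'I_n) : 'cV[R]_d :=
  invsqrtmx (precond_mx x rho) *m x i.

Definition precond_loss (i : 'I_n) (v : 'cV[R]_d) : R :=
  phi loss beta (dot v (precond_pt i)) (y i).

Definition precond_dom (i : 'I_n) : set 'cV[R]_d :=
  [set v | `|dot v (precond_pt i)| <= r].

Definition common_lipschitz (K : R) : Prop :=
  0 <= K /\
  forall i u v, precond_dom i u -> precond_dom i v ->
    `|precond_loss i u - precond_loss i v| <= K * enorm (u - v).

Definition common_smooth (K : R) : Prop :=
  0 <= K /\
  forall i,
    (forall v, precond_dom i v -> differentiable (precond_loss i) v) /\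
    forall u v, precond_dom i u -> precond_dom i v ->
      enorm (grad (precond_loss i) u - grad (precond_loss i) v)
        <= K * enorm (u - v).

Definition is_smallest (S : set R) (K : R) : Prop := S K /\ lbound S K.

(* The condition numbers are given as relations because a smallest constant
   need not exist for an arbitrary loss; it is unique when it does. *)
Definition cond_number_lipschitz (kappa : R) : Prop :=
  exists2 K, is_smallest common_lipschitz K & kappa = K ^+ 2 / beta.

Definition cond_number_smooth (kappa : R) : Prop :=
  exists2 K, is_smallest common_smooth K & kappa = K / beta.

End ConditionNumber.

(* Main.v *)
Require Import Defs.
From HB Require Import structures.
From mathcomp Require Import all_boot all_order all_algebra.
From mathcomp Require Import all_classical all_reals all_analysis.
From mathcomp Require Import ring lra.

Set Implicit Arguments.
Unset Strict Implicit.
Unset Printing Implicit Defensive.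

Import Order.TTheory GRing.Theory Num.Theory.
Import numFieldNormedType.Exports.

Local Open Scope ring_scope.
Local Open Scope classical_set_scope.

(** Write [p_i = H^(-1/2) x_i].  The [i]-th preconditioned loss is a ridge
    function: it is the scalar function [phi] evaluated at the inner product of
    [v] with [p_i].  By Cauchy-Schwarz its Lipschitz constant is at most the
    Lipschitz constant of [phi] times the length of [p_i], and the gradient
    [phi' *: p_i] is Lipschitz with constant that of [phi'] times the squared
    length.  Two facts then give the theorem.

    The squared length of [p_i] is [x_i^T H^-1 x_i], where [H] is diagonalized
    by the left singular vectors [U] with eigenvalues [sigma_j^2 + rho].  Hence
    it equals [n] times the [i]-th ridge leverage score, and the incoherence
    times the numerical rank is the maximum of these numbers
    ([sqr_enorm_precond_pt_le]).

    Subtracting the quadratic costs at most [beta * r] in the Lipschitz constant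
    on [[-r, r]] ([phi_lipschitz]).  For the derivative it is a gain: the
    curvature bound makes [loss' - beta * z] nondecreasing, so that its
    increments lie between [0] and [L - beta] times those of [z]
    ([derive1_sub_linear_lipschitz]).

    The constants [(L + beta * r) * sqrt M] and [(L - beta) * M] obtained this
    way, with [M] the incoherence times the numerical rank, turn the required
    bounds into the assumed inequalities.  The smallest constant exists
    because the admissible constants form a nonempty closed set of nonnegative
    reals. *)

(** * Euclidean inner product *)

Section InnerProduct.
Context {R : realType} {d : nat}.
Implicit Types (u v w : 'cV[R]_d) (A : 'M[R]_d).

Lemma dotC u v : dot u v = dot v u.
Proof. by apply: eq_bigr => j _; rewrite mulrC. Qed.

Lemma dotZl a u v : dot (a *: u) v = a * dot u v.
Proof. by rewrite mulr_sumr; apply: eq_bigr => j _; rewrite mxE mulrA. Qed.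

Lemma dotDl u v w : dot (u + v) w = dot u w + dot v w.
Proof. by rewrite -big_split; apply: eq_bigr => j _; rewrite !mxE mulrDl. Qed.

Lemma dotBl u v w : dot (u - v) w = dot u w - dot v w.
Proof. by rewrite dotDl -scaleN1r dotZl mulN1r. Qed.

Lemma dotBr u v w : dot w (u - v) = dot w u - dot w v.
Proof. by rewrite dotC dotBl !(dotC w). Qed.

Lemma dotZr a u v : dot v (a *: u) = a * dot v u.
Proof. by rewrite dotC dotZl dotC. Qed.

Lemma dot_ge0 v : 0 <= dot v v.
Proof. by apply: sumr_ge0 => j _; rewrite -expr2 sqr_ge0. Qed.

Lemma dot_eq0 u v : dot v v = 0 -> dot u v = 0.
Proof.
move=> /eqP; rewrite psumr_eq0; last by move=> j _; rewrite -expr2 sqr_ge0.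
move=> /allP v0; apply: big1 => j _.
have := v0 j (mem_index_enum j).
by rewrite /= mulf_eq0 orbb => /eqP ->; rewrite mulr0.
Qed.

Lemma dot_mulmxr A u v : dot u (A *m v) = dot (A^T *m u) v.
Proof.
have dotE (a b : 'cV[R]_d) : dot a b = (a^T *m b) 0 0.
  by rewrite mxE; apply: eq_bigr => j _; rewrite mxE.
by rewrite !dotE trmx_mul trmxK mulmxA.
Qed.

Lemma enorm_ge0 v : 0 <= enorm v.
Proof. exact: sqrtr_ge0. Qed.

Lemma sqr_enorm v : enorm v ^+ 2 = dot v v.
Proof. by rewrite sqr_sqrtr ?dot_ge0. Qed.

Lemma enormZ a v : enorm (a *: v) = `|a| * enorm v.
Proof.
by rewrite /enorm dotZl dotZr mulrA -expr2 sqrtrM ?sqr_ge0// sqrtr_sqr.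
Qed.

(** The Gram-Schmidt residual of [u] along [v], scaled by [dot v v] to avoid
    division, has a nonnegative square. *)
Lemma enorm_cauchy_schwarz u v : `|dot u v| <= enorm u * enorm v.
Proof.
have [v0|vN0] := eqVneq (dot v v) 0.
  by rewrite dot_eq0// normr0 mulr_ge0 ?enorm_ge0.
have v_gt0 : 0 < dot v v by rewrite lt_neqAle eq_sym vN0 dot_ge0.
suff: dot u v ^+ 2 <= dot u u * dot v v.
  rewrite -!sqr_enorm -exprMn -[X in X <= _]real_normK ?num_real//.
  by rewrite ler_pXn2r ?nnegrE ?mulr_ge0 ?enorm_ge0.
have := dot_ge0 (dot v v *: u - dot u v *: v).
rewrite dotBl !dotBr !dotZl !dotZr (dotC v u).
rewrite [X in 0 <= X](_ : _ = dot v v * (dot u u * dot v v - dot u v ^+ 2)).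
  by rewrite pmulr_rge0// subr_ge0.
by ring.
Qed.

End InnerProduct.

Lemma invmx_eq (F : comUnitRingType) m (A B : 'M[F]_m) :
  A *m B = 1%:M -> invmx A = B.
Proof.
by move=> AB; have [Au _] := mulmx1_unit AB; rewrite -(mulKmx Au B) AB mulmx1.
Qed.

(** * Length of the preconditioned data points *)

Section SpectralFunction.
Context {R : realType} {d : nat}.
Implicit Types (U : 'M[R]_d) (mu : 'I_d -> R) (f g : R -> R).

(** The functional calculus [f(A)] of the matrix [A] with eigenvectors the
    columns of [U] and eigenvalues [mu]: the inverse and the inverse square root
    of [A] are instances, and their products are computed on the eigenvalues. *)
Definition spectral_fun U mu f : 'M[R]_d :=
  U *m diag_mx (\row_j f (mu j)) *m U^T.

Lemma spectral_funM U mu f g : U^T *m U = 1%:M ->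
  spectral_fun U mu f *m spectral_fun U mu g = spectral_fun U mu (f \* g).
Proof.
move=> UTU; rewrite /spectral_fun !mulmxA.
rewrite -[X in X *m diag_mx _ *m _ = _]mulmxA UTU mulmx1.
rewrite -[X in X *m _ = _]mulmxA mulmx_diag.
by congr (_ *m diag_mx _ *m _); apply/rowP => j; rewrite !mxE.
Qed.

Lemma spectral_fun1 U mu : U^T *m U = 1%:M ->
  spectral_fun U mu (fun=> 1) = 1%:M.
Proof.
move=> UTU; rewrite /spectral_fun.
rewrite (_ : diag_mx _ = 1%:M) ?mulmx1 ?(mulmx1C UTU)//.
by apply/matrixP => i j; rewrite !mxE.
Qed.

Lemma eq_spectral_fun U mu f g : (forall j, f (mu j) = g (mu j)) ->
  spectral_fun U mu f = spectral_fun U mu g.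
Proof.
by move=> fg; congr (_ *m diag_mx _ *m _); apply/rowP => j; rewrite !mxE.
Qed.

Lemma tr_spectral_fun U mu f : (spectral_fun U mu f)^T = spectral_fun U mu f.
Proof. by rewrite /spectral_fun !trmx_mul trmxK tr_diag_mx mulmxA. Qed.

Lemma dot_spectral_fun U mu f v : dot v (spectral_fun U mu f *m v) =
  \sum_j f (mu j) * (U^T *m v) j 0 ^+ 2.
Proof.
rewrite /spectral_fun -!mulmxA dot_mulmxr; apply: eq_bigr => j _.
by rewrite mul_diag_mx !mxE; ring.
Qed.

End SpectralFunction.

Section Preconditioner.
Context {R : realType} {d n : nat}.
Variables (x : 'I_n -> 'cV[R]_d) (U : 'M[R]_d) (sigma : 'I_d -> R).
Variables (V : 'M[R]_(n, d)) (rho : R).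
Hypotheses (n_gt0 : (0 < n)%N) (rho_gt0 : 0 < rho) (svd : is_svd x U sigma V).

Let shifted_gt0 j : 0 < sigma j ^+ 2 + rho.
Proof. by rewrite ltr_wpDl ?sqr_ge0. Qed.

Let UTU : U^T *m U = 1%:M. Proof. by case: svd. Qed.

Let data_mxE : data_mx x =
  Num.sqrt n%:R *: (U *m diag_mx (\row_j sigma j) *m V^T).
Proof.
case: svd => <- *.
by rewrite scalerA divff ?scale1r// gt_eqF// sqrtr_gt0 ltr0n.
Qed.

(** [X X^T / n] loses its right singular vectors because [V^T V = 1], and
    [rho%:M] commutes with [U]. *)
Lemma precond_mx_svd :
  precond_mx x rho = spectral_fun U (fun j => sigma j ^+ 2 + rho) id.
Proof.
have -> : precond_mx x rho =
    rho%:M + n%:R^-1 *: (data_mx x *m (data_mx x)^T).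
  congr (_ + _ *: _); apply/matrixP => j k; rewrite summxE !mxE.
  by apply: eq_bigr => i _; rewrite !mxE big_ord1 !mxE.
have VTV : V^T *m V = 1%:M by case: svd.
rewrite data_mxE linearZ/= -scalemxAl -scalemxAr !scalerA.
rewrite -mulrA -expr2 sqr_sqrtr ?ler0n// mulVf ?pnatr_eq0 -?lt0n// scale1r.
rewrite !trmx_mul trmxK tr_diag_mx !mulmxA.
rewrite -[X in X *m diag_mx _ *m _]mulmxA VTV mulmx1.
rewrite -[X in X *m U^T]mulmxA mulmx_diag.
rewrite -[rho%:M]mulmx1 -(mulmx1C UTU) mulmxA -scalar_mxC -mulmxDl -mulmxDr.
congr (_ *m _ *m _); apply/matrixP => j k; rewrite !mxE.
by case: eqP => _; rewrite ?mulr1n ?mulr0n ?addr0// addrC expr2.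
Qed.

Lemma precond_inv_svd : invmx (precond_mx x rho) =
  spectral_fun U (fun j => sigma j ^+ 2 + rho) GRing.inv.
Proof.
rewrite precond_mx_svd; apply: invmx_eq; rewrite spectral_funM//.
rewrite -(spectral_fun1 (fun j => sigma j ^+ 2 + rho) UTU).
by apply: eq_spectral_fun => j /=; rewrite divff ?gt_eqF.
Qed.

(** Exhibiting one positive semidefinite square root of the inverse is enough:
    the choice operator then returns a matrix with the same two properties,
    which are all that the length of [p_i] depends on. *)
Lemma invsqrtmx_precond (S := invsqrtmx (precond_mx x rho)) :
  psd S /\ S *m S = invmx (precond_mx x rho).
Proof.
apply: (@getPex _ [set S | psd S /\ S *m S = invmx (precond_mx x rho)]).
exists (spectral_fun U (fun j => sigma j ^+ 2 + rho)
  (fun t => (Num.sqrt t)^-1)); split; last first.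
  rewrite precond_inv_svd spectral_funM//; apply: eq_spectral_fun => j /=.
  by rewrite -invfM -expr2 sqr_sqrtr// ltW.
split=> [|v]; first exact: tr_spectral_fun.
rewrite dot_spectral_fun; apply: sumr_ge0 => j _.
by rewrite mulr_ge0 ?sqr_ge0// invr_ge0 sqrtr_ge0.
Qed.

(** The squared length is [x_i^T H^-1 x_i], and the coordinates of [x_i] in the
    basis [U] are [sqrt n * sigma_j * V_ij]. *)
Lemma sqr_enorm_precond_pt i : enorm (precond_pt rho x i) ^+ 2 =
  n%:R * \sum_j sigma j ^+ 2 / (sigma j ^+ 2 + rho) * V i j ^+ 2.
Proof.
have [[St _] SS] := invsqrtmx_precond.
rewrite sqr_enorm /precond_pt dot_mulmxr mulmxA St SS dotC precond_inv_svd.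
rewrite dot_spectral_fun mulr_sumr; apply: eq_bigr => j _.
have -> : x i = col i (data_mx x) by apply/colP => k; rewrite !mxE.
rewrite colE mulmxA -colE mxE data_mxE -scalemxAr !mulmxA UTU.
rewrite mul1mx mul_diag_mx !mxE.
by rewrite exprMn sqr_sqrtr ?ler0n//; field; rewrite gt_eqF.
Qed.

Lemma sqr_enorm_precond_pt_le i :
  enorm (precond_pt rho x i) ^+ 2
    <= incoherence sigma V rho * numrank sigma rho.
Proof.
have w_ge0 j : 0 <= sigma j ^+ 2 / (sigma j ^+ 2 + rho).
  by rewrite divr_ge0 ?sqr_ge0// ltW.
rewrite sqr_enorm_precond_pt.
(* If the numerical rank vanishes, the quotient in the incoherence is zero by
   convention, but then so is every summand of the leverage score. *)
have [g0|gN0] := eqVneq (numrank sigma rho) 0.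
  rewrite g0 mulr0 big1 ?mulr0// => j _.
  move/eqP: g0; rewrite psumr_eq0// => /allP/(_ j (mem_index_enum j)) /eqP ->.
  by rewrite mul0r.
have g_gt0 : 0 < numrank sigma rho by rewrite lt_neqAle eq_sym gN0 sumr_ge0.
rewrite -ler_pdivrMr// mulrAC.
exact: (le_bigmax 0 (fun i => n%:R / numrank sigma rho *
  \sum_j sigma j ^+ 2 / (sigma j ^+ 2 + rho) * V i j ^+ 2) i).
Qed.

End Preconditioner.

(** * Existence of smallest constants *)

Section Smallest.
Context {R : realType}.

(** The smallest element is the infimum.  The last hypothesis, that [S] is
    upward closed and closed, is put in the form in which [inf_adherent] applies
    to it. *)
Lemma is_smallest_exists (S : set R) (K0 : R) :
  S K0 -> lbound S 0 ->
  (forall K, (forall e, 0 < e -> exists2 K', S K' & K' <= K + e) -> S K) ->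
  exists2 K, is_smallest S K & K <= K0.
Proof.
move=> SK0 S_ge0 S_closed; have lS : has_lbound S by exists 0.
have infS : lbound S (inf S) by exact: ge_inf.
exists (inf S); last exact: infS.
split=> //; apply: S_closed => e e_gt0.
have hS : has_inf S by split=> //; exists K0.
by have [K' SK' /ltW] := inf_adherent e_gt0 hS; exists K'.
Qed.

(** A bound [a <= K * b] passes to the infimum of its admissible constants. *)
Lemma ler_mul_approx (S : set R) (K a b : R) : 0 <= b ->
  (forall K', S K' -> a <= K' * b) ->
  (forall e, 0 < e -> exists2 K', S K' & K' <= K + e) -> a <= K * b.
Proof.
move=> b_ge0 Sab SK; have [b0|bN0] := eqVneq b 0.
  by have [K' /Sab] := SK 1 ltr01; rewrite b0 !mulr0.
have b_gt0 : 0 < b by rewrite lt_neqAle eq_sym bN0.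
rewrite -ler_pdivrMr//; apply/ler_addgt0Pr => e e_gt0.
by have [K' /Sab] := SK e e_gt0; rewrite -ler_pdivrMr// => /le_trans; apply.
Qed.

End Smallest.

Section ConditionNumbers.
Context {R : realType} {d n : nat}.
Variables (Y : Type) (loss : R -> Y -> R) (beta rho r : R).
Variables (x : 'I_n -> 'cV[R]_d) (y : 'I_n -> Y).

Lemma smallest_common_lipschitz K0 :
  common_lipschitz loss beta rho r x y K0 ->
  exists2 K, is_smallest (common_lipschitz loss beta rho r x y) K & K <= K0.
Proof.
move=> SK0; apply: is_smallest_exists => //; first by move=> K [].
move=> K SK; split.
  rewrite -[K]mulr1; apply: ler_mul_approx SK => // K' [].
  by rewrite mulr1.
move=> i u v ui vi; apply: ler_mul_approx SK; first exact: enorm_ge0.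
by move=> K' [_ /(_ i u v ui vi)].
Qed.

Lemma smallest_common_smooth K0 :
  common_smooth loss beta rho r x y K0 ->
  exists2 K, is_smallest (common_smooth loss beta rho r x y) K & K <= K0.
Proof.
move=> SK0; apply: is_smallest_exists => //; first by move=> K [].
move=> K SK; split.
  rewrite -[K]mulr1; apply: ler_mul_approx SK => // K' [].
  by rewrite mulr1.
move=> i; split; first by case: SK0 => _ /(_ i)[].
move=> u v ui vi; apply: ler_mul_approx SK; first exact: enorm_ge0.
by move=> K' [_ /(_ i)[_ /(_ u v ui vi)]].
Qed.

End ConditionNumbers.

(** * Scalar losses with the quadratic removed *)

Section Losses.
Context {R : realType}.
Implicit Types (f : R -> R) (r L beta z t s : R).

Lemma klipschitz_itv L r f z t : L.-lipschitz_`[- r, r] f ->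
  `|z| <= r -> `|t| <= r -> `|f z - f t| <= L * `|z - t|.
Proof.
move=> fL zr tr; have := fL (z, t); rewrite /= !in_itv/= -!ler_norml.
exact.
Qed.

(** [beta / 2 * (z^2 - t^2)] is [beta] times the midpoint of [z] and [t], which
    lies in [[-r, r]], times [z - t]. *)
Lemma phi_lipschitz (Y : Type) (loss : R -> Y -> R) y beta L r z t :
  0 <= beta ->
  L.-lipschitz_`[- r, r] (loss ^~ y) -> `|z| <= r -> `|t| <= r ->
  `|phi loss beta z y - phi loss beta t y| <= (L + beta * r) * `|z - t|.
Proof.
move=> beta_ge0 lossL zr tr; rewrite /phi.
rewrite (_ : _ - _ = (loss z y - loss t y) - beta * ((z + t) / 2) * (z - t));
  last by field.
apply: le_trans (ler_normB _ _) _; rewrite [leRHS]mulrDl.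
apply: lerD (klipschitz_itv lossL zr tr) _.
rewrite !normrM (ger0_norm beta_ge0) -!mulrA ler_wpM2l// mulrA ler_wpM2r//.
rewrite normfV (@ger0_norm _ 2)// ler_pdivrMr// mulr_natr mulr2n.
by apply: le_trans (ler_normD _ _) (lerD zr tr).
Qed.

Lemma derive1_sub_linear_nondecreasing f beta r z t :
  (forall s, `|s| <= r -> twice_derivable_at f s /\ beta <= f^`(2) s) ->
  `|z| <= r -> `|t| <= r -> z <= t ->
  f^`()%classic z - beta * z <= f^`()%classic t - beta * t.
Proof.
move=> f2; rewrite !ler_norml => /andP[zr _] /andP[_ tr] zt.
have der s : s \in `[- r, r]%R ->
    is_derive s 1 (fun s => f^`()%classic s - beta * s)
      (f^`(2)%classic s - beta).
  rewrite in_itv/= -ler_norml => /f2[[_ f's] _].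
  apply: is_deriveB; first by rewrite derive1E; exact/derivableP.
  by apply: is_derive_eq; rewrite /GRing.scale/= mulr1.
pose g s := f^`()%classic s - beta * s.
apply: (@ger0_derive1_ndecr _ g (- r) r) => //.
- by move=> s /subset_itv_oo_cc /der [].
- move=> s /subset_itv_oo_cc sr; have sd := der s sr.
  rewrite derive1E derive_val subr_ge0.
  by move: sr; rewrite in_itv/= -ler_norml => /f2[].
- by apply: derivable_within_continuous => s /der [].
Qed.

(** Compare the two bounds on the increment of [f'] from [- r] to [r]; the
    interval is nondegenerate. *)
Lemma smooth_ge_curvature f beta L r : 0 < r ->
  (forall s, `|s| <= r -> twice_derivable_at f s /\ beta <= f^`(2) s) ->
  smooth_on `[- r, r] L f -> beta <= L.
Proof.
move=> r_gt0 f2 [_ f'L].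
have rr : `|r| <= r by rewrite ger0_norm // ltW.
have Nrr : `|- r| <= r by rewrite normrN.
have := derive1_sub_linear_nondecreasing f2 Nrr rr.
have -> : - r <= r by lra.
have := klipschitz_itv f'L rr Nrr.
rewrite opprK (@ger0_norm _ (r + r)); last lra.
move=> /(le_trans (ler_norm _)) fL /(_ isT) fb.
rewrite -(@ler_pM2r _ (r + r)); lra.
Qed.

(** For [z <= t] the increment of [f' - beta * z] is nonnegative by
    monotonicity, hence equal to its absolute value, and at most
    [(L - beta) * (t - z)] by smoothness.  The triangle inequality alone would
    only give [L + beta]. *)
Lemma derive1_sub_linear_lipschitz f beta L r z t :
  (forall s, `|s| <= r -> twice_derivable_at f s /\ beta <= f^`(2) s) ->
  smooth_on `[- r, r] L f -> `|z| <= r -> `|t| <= r ->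
  `|(f^`()%classic z - beta * z) - (f^`()%classic t - beta * t)|
    <= (L - beta) * `|z - t|.
Proof.
move=> f2 [_ f'L]; wlog zt : z t / z <= t => [th zr tr|zr tr].
  have [zt|/ltW tz] := leP z t; first exact: th.
  by rewrite distrC (distrC z); exact: th.
have mono := derive1_sub_linear_nondecreasing f2 zr tr zt.
have := le_trans (ler_norm _) (klipschitz_itv f'L tr zr).
rewrite (distrC z t) (@ger0_norm _ (t - z)) ?subr_ge0// => f'tz.
by rewrite distrC ger0_norm; lra.
Qed.

End Losses.

(** * Ridge functions *)

Section ChainRule.
Context {R : realType} {d : nat}.
Variable p : 'cV[R]_d.

Lemma differentiable_dotl v : differentiable (fun u : 'cV[R]_d => dot u p) v.
Proof.
rewrite (_ : (fun u : 'cV[R]_d => dot u p) =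
    \sum_j (fun u : 'cV[R]_d => p j 0 *: (u j 0 : R^o))); last first.
  by apply/funext => u; rewrite fct_sumE; apply: eq_bigr => j _; rewrite mulrC.
by apply: differentiable_sum => j; apply/differentiableZ/differentiable_coord.
Qed.

Lemma diff_dotl v :
  'd (fun u : 'cV[R]_d => dot u p) v = (fun u => dot u p) :> (_ -> R).
Proof.
have lin : linear ((fun u => dot u p) : 'cV[R]_d -> R^o).
  by move=> a u w; rewrite dotDl dotZl.
pose linM := GRing.isLinear.Build _ _ _ _ _ lin.
pose f : {linear 'cV[R]_d -> R^o} :=
  HB.pack (fun u : 'cV[R]_d => dot u p : R^o) linM.
rewrite (@diff_lin _ _ _ f)// => u.
exact/differentiable_continuous/differentiable_dotl.
Qed.

Lemma differentiable_ridge (g : R -> R) v : derivable g (dot v p) 1 ->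
  differentiable (fun u => g (dot u p)) v.
Proof.
move=> /derivable1_diffP dg.
exact: (differentiable_comp (differentiable_dotl v)).
Qed.

Lemma grad_ridge (g : R -> R) v : derivable g (dot v p) 1 ->
  grad (fun u => g (dot u p)) v = g^`()%classic (dot v p) *: p.
Proof.
move=> dg; apply/colP => j; rewrite !mxE.
rewrite deriveE; last exact: differentiable_ridge.
have dg' : differentiable g (dot v p) by exact/derivable1_diffP.
rewrite (diff_comp (differentiable_dotl v) dg') /= diff_dotl diff1E //=.
rewrite /GRing.scale /= mulrC; congr (_ * _).
rewrite /dot (bigD1 j)//= big1 => [|k kj].
  by rewrite !mxE !eqxx mul1r addr0.
by rewrite mxE (negPf kj) mul0r.
Qed.

End ChainRule.

(** * Constants for the preconditioned problem *)

Section Bounds.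
Context {R : realType} {d n : nat}.
Variables (Y : Type) (loss : R -> Y -> R) (beta rho r L M : R).
Variables (x : 'I_n -> 'cV[R]_d) (y : 'I_n -> Y).
Hypothesis pM : forall i, enorm (precond_pt rho x i) ^+ 2 <= M.

Lemma common_lipschitz_precond : 0 <= r -> 0 <= beta -> 0 <= L ->
  (forall i, L.-lipschitz_`[- r, r] (loss ^~ (y i))) ->
  common_lipschitz loss beta rho r x y ((L + beta * r) * Num.sqrt M).
Proof.
move=> r_ge0 beta_ge0 L_ge0 lossL.
have K_ge0 : 0 <= L + beta * r by rewrite addr_ge0// mulr_ge0.
split=> [|i u v ui vi]; first by rewrite mulr_ge0// sqrtr_ge0.
apply: le_trans (phi_lipschitz beta_ge0 (lossL i) ui vi) _.
rewrite -mulrA ler_wpM2l// -dotBl.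
apply: le_trans (enorm_cauchy_schwarz _ _) _.
rewrite mulrC ler_wpM2r ?enorm_ge0// -[leLHS]ger0_norm ?enorm_ge0//.
by rewrite -sqrtr_sqr ler_wsqrtr.
Qed.

Lemma common_smooth_precond : 0 <= M -> beta <= L ->
  (forall i s, `|s| <= r ->
    twice_derivable_at (loss ^~ (y i)) s /\ beta <= (loss ^~ (y i))^`(2) s) ->
  (forall i, smooth_on `[- r, r] L (loss ^~ (y i))) ->
  common_smooth loss beta rho r x y ((L - beta) * M).
Proof.
move=> M_ge0 betaL loss2 lossL.
have phi' i (v : 'cV[R]_d) : precond_dom rho r x i v ->
    is_derive (dot v (precond_pt rho x i)) 1 (phi loss beta ^~ (y i))
      ((loss ^~ (y i))^`()%classic (dot v (precond_pt rho x i))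
         - beta * dot v (precond_pt rho x i)).
  set z := dot v _ => vi.
  have dz : derivable (loss ^~ (y i)) z 1.
    by case: (lossL i) => + _; apply; rewrite /= in_itv/= -ler_norml.
  apply: is_deriveB; first by rewrite derive1E; exact/derivableP.
  by apply: is_derive_eq; rewrite /GRing.scale/= mulr1; field.
split=> [|i]; first by rewrite mulr_ge0 ?subr_ge0.
split=> [v /phi' [dphi _]|u v ui vi].
  exact: (@differentiable_ridge _ _ _ (phi loss beta ^~ (y i))).
have gradE w : precond_dom rho r x i w ->
    grad (precond_loss loss beta rho x y i) w =
    ((loss ^~ (y i))^`()%classic (dot w (precond_pt rho x i))
      - beta * dot w (precond_pt rho x i)) *: precond_pt rho x i.
  move=> /phi' dw; rewrite (@grad_ridge _ _ _ (phi loss beta ^~ (y i)))//.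
  by rewrite derive1E derive_val.
rewrite !gradE// -scalerBl enormZ.
have step := derive1_sub_linear_lipschitz (loss2 i) (lossL i) ui vi.
apply: le_trans (ler_wpM2r (enorm_ge0 _) step) _.
rewrite -!mulrA ler_wpM2l ?subr_ge0// -dotBl.
apply: le_trans (ler_wpM2r (enorm_ge0 _) (enorm_cauchy_schwarz _ _)) _.
by rewrite -mulrA -expr2 mulrC ler_wpM2r ?enorm_ge0.
Qed.

End Bounds.

(** * Comparison of the condition numbers *)

Theorem mainTheorem2 (R : realType) (d n : nat) (hdn : (d <= n)%N)
    (x : 'I_n -> 'cV[R]_d) (hx : exists i, x i != 0)
    (Y : Type) (y : 'I_n -> Y)
    (r : R) (hr : 0 < r)
    (loss : R -> Y -> R)
    (hconvex : forall b : Y, convex_function `[- r, r] (loss ^~ b : R -> R^o))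
    (beta lambda L Rmax rho : R)
    (hbeta : 0 < beta) (hlambda : 0 < lambda) (hL : 0 < L)
    (hrho : rho = lambda / beta)
    (hd2 : forall (i : 'I_n) (z : R), `|z| <= r ->
       twice_derivable_at (loss ^~ (y i)) z /\
       beta <= (loss ^~ (y i))^`(2) z)
    (hRmax : forall i, enorm (x i) <= Rmax)
    (U : 'M[R]_d) (sigma : 'I_d -> R) (V : 'M[R]_(n, d))
    (hsvd : is_svd x U sigma V) :
  ((forall i, L.-lipschitz_`[- r, r] (loss ^~ (y i))) ->
   lambda * (L + beta * r) ^+ 2 / (beta * L ^+ 2)
     <= Rmax ^+ 2 / (incoherence sigma V rho * numrank sigma rho) ->
   exists2 kappa, cond_number_lipschitz loss beta rho r x y kappa
                & kappa <= L ^+ 2 * Rmax ^+ 2 / lambda)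
  /\
  ((forall i, smooth_on `[- r, r] L (loss ^~ (y i))) ->
   lambda / beta - lambda / L
     <= Rmax ^+ 2 / (incoherence sigma V rho * numrank sigma rho) ->
   exists2 kappa, cond_number_smooth loss beta rho r x y kappa
                & kappa <= L * Rmax ^+ 2 / lambda).
Proof.
have [i0 _] := hx.
have n_gt0 : (0 < n)%N by case: (i0) => k; apply: leq_trans.
have rho_gt0 : 0 < rho by rewrite hrho divr_gt0.
set M := incoherence sigma V rho * numrank sigma rho.
have pM i : enorm (precond_pt rho x i) ^+ 2 <= M.
  exact: (sqr_enorm_precond_pt_le n_gt0 rho_gt0 hsvd).
have M_ge0 : 0 <= M by apply: le_trans (pM i0); rewrite sqr_ge0.
clearbody M.
split=> lossL cond.
- have [K K_min K_le] := smallest_common_lipschitz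
    (common_lipschitz_precond pM (ltW hr) (ltW hbeta) (ltW hL) lossL).
  exists (K ^+ 2 / beta); first by exists K.
  have K_ge0 : 0 <= K by case: K_min => -[].
  have Lr_gt0 : 0 < L + beta * r by rewrite addr_gt0// mulr_gt0.
  (* For M = 0 the right-hand side of the condition is zero by convention,
     while its left-hand side is positive. *)
  have M_gt0 : 0 < M.
    rewrite lt_neqAle M_ge0 andbT; apply/eqP => M0.
    move: cond; rewrite -M0 invr0 mulr0.
    by rewrite leNgt divr_gt0// mulr_gt0// exprn_gt0.
  have K2 : K ^+ 2 <= (L + beta * r) ^+ 2 * M.
    rewrite -(sqr_sqrtr M_ge0) -exprMn ler_pXn2r// nnegrE.
    by rewrite mulr_ge0 ?sqrtr_ge0// ltW.
  move: cond; rewrite ler_pdivrMr ?mulr_gt0 ?exprn_gt0//.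
  rewrite mulrAC ler_pdivlMr// => cond.
  rewrite ler_pdivrMr// mulrAC ler_pdivlMr//.
  rewrite (le_trans (ler_wpM2r (ltW hlambda) K2))//.
  by lra.
- have betaL : beta <= L := smooth_ge_curvature hr (hd2 i0) (lossL i0).
  have [K K_min K_le] := smallest_common_smooth
    (common_smooth_precond pM M_ge0 betaL hd2 lossL).
  exists (K / beta); first by exists K.
  rewrite ler_pdivrMr// mulrAC ler_pdivlMr//.
  apply: le_trans (ler_wpM2r (ltW hlambda) K_le) _.
  have [M0|M_neq0] := eqVneq M 0.
    rewrite M0 mulr0 mul0r.
    exact: mulr_ge0 (mulr_ge0 (ltW hL) (sqr_ge0 _)) (ltW hbeta).
  have M_gt0 : 0 < M by rewrite lt_neqAle eq_sym M_neq0.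
  move: cond; rewrite ler_pdivlMr//.
  have -> : (lambda / beta - lambda / L) * M =
      (L - beta) * M * lambda / (L * beta) by field; rewrite !gt_eqF.
  by rewrite ler_pdivrMr ?mulr_gt0//; lra.
Qed.
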